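(* There is a constant $K\leqslant\frac{\pi^2}{6}$ with the following properties. (a) $\|z\|_{\pi,n}\leqslant 2K\|z\|_{ah,2n+1}$ for every $n\in\mathbb{N}$ and every $z\in\mathcal{S}\otimes\mathcal{S}$. (b) For every continuous bilinear form $u\colon\mathcal{S}\times\mathcal{S}\to\mathbb{C}$, every $n,m\in\mathbb{N}$ and all $x_1,\dots,x_m,y_1,\dots,y_m\in\mathcal{S}$, \[\Big|\sum_{j=1}^mu(x_j,y_j)\Big|\leqslant K\|u\|_n^*\,\|(x_j)\|_{2n+1}^{rc}\,\|(y_j)\|_{2n+1}^{rc}.\] (c) In particular, for every $\phi\in\mathcal{S}'$, every $n,m\in\mathbb{N}$ and all $x_1,\dots,x_m\in\mathcal{S}$, \[\sum_{j=1}^m|\phi(x_j)|^2\leqslant K\big(\|\phi\|_n^*\,\|(x_j)\|_{2n+1}^{rc}\big)^2.\]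
   Context: Let $\mathbb{N}=\{1,2,\dots\}$. Let $s$ be the space of complex sequences $\xi=(\xi_j)_{j\geqslant1}$ with $|\xi|_n:=(\sum_{j}|\xi_j|^2j^{2n})^{1/2}<\infty$ for all $n\in\mathbb{N}$, and let $s'$ be its dual, the space of sequences $\eta$ with $|\eta|_n':=(\sum_j|\eta_j|^2j^{-2n})^{1/2}<\infty$ for some $n$, with pairing $\langle\xi,\eta\rangle=\sum_j\xi_j\overline{\eta_j}$. The noncommutative Schwartz space $\mathcal{S}=L(s',s)$ is the Fréchet space of continuous linear operators $s'\to s$ with the topology of uniform convergence on bounded sets; it is a $*$-algebra with product $xy:=x\circ\iota\circ y$ ($\iota\colon s\hookrightarrow s'$ the inclusion) and involution given by $\langle x^*\xi,\eta\rangle=\langle\xi,x\eta\rangle$; $\mathcal{S}'$ is its topological dual. For $n\in\mathbb{N}$ and $x\in\mathcal{S}$, $\|x\|_n:=\sup\{|x\xi|_n\colon \xi\in s',\ |\xi|_n'\leqslant1\}$. For a continuous bilinear form $u$, $\|u\|_n^*:=\sup\{|u(x,y)|\colon\|x\|_n\leqslant1,\|y\|_n\leqslant1\}$, and for $\phi\in\mathcal{S}'$, $\|\phi\|_n^*:=\sup\{|\phi(x)|\colon\|x\|_n\leqslant1\}$. For $x_1,\dots,x_m\in\mathcal{S}$ and $k\in\mathbb{N}$, $\|(x_j)\|_k^{rc}:=\max\{\|\sum_jx_j^*x_j\|_k^{1/2},\|\sum_jx_jx_j^*\|_k^{1/2}\}$. On the algebraic tensor product $\mathcal{S}\otimes\mathcal{S}$: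 $\|z\|_{\pi,n}:=\inf\sum_j\|x_j\|_n\|y_j\|_n$ and $\|z\|_{ah,n}:=\inf\|\sum_j|x_j|^2\|_n^{1/2}\|\sum_j|y_j|^2\|_n^{1/2}$, where $|x|^2:=\frac12(x^*x+xx^* )$ and both infima run over all representations $z=\sum_{j=1}^mx_j\otimes y_j$. *)

(* Defs.v *)
From HB Require Import structures.
From mathcomp Require Import all_boot all_order all_algebra.
From mathcomp Require Import all_classical all_reals all_analysis.
From mathcomp Require Import complex.
From Stdlib Require Import ClassicalEpsilon.

Set Implicit Arguments.
Unset Strict Implicit.
Unset Printing Implicit Defensive.

Import Order.TTheory GRing.Theory Num.Theory.
Local Open Scope ring_scope.

Section NoncommutativeSchwartz.
Variable R : realType.
Local Notation C := R[i].

(* complex sequences xi = (xi_j)_{j>=1}; the paper's index j is our j.+1 *)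
Definition cseq := nat -> C.
(* (candidate) operators s' -> s; only their values on s' matter *)
Definition op := cseq -> cseq.

Definition cabs (z : C) : R := Num.sqrt (complex.Re z ^+ 2 + complex.Im z ^+ 2).

Definition esqrt (e : \bar R) : \bar R :=
  match e with
  | EFin r => (Num.sqrt r)%:E
  | +oo%E => +oo%E
  | -oo%E => 0%E
  end.

Definition snorm (n : nat) (xi : cseq) : \bar R :=
  esqrt (\sum_(j <oo) ((cabs (xi j)) ^+ 2 * (j.+1)%:R ^+ (2 * n))%:E)%E.
Definition dnorm (n : nat) (xi : cseq) : \bar R :=
  esqrt (\sum_(j <oo) ((cabs (xi j)) ^+ 2 / (j.+1)%:R ^+ (2 * n))%:E)%E.

Definition in_s (xi : cseq) : Prop := forall n, (snorm n xi < +oo)%E.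
Definition in_s' (xi : cseq) : Prop := exists n, (dnorm n xi < +oo)%E.

Definition pairing (xi eta : cseq) : C :=
  Complex (limn (fun N => \sum_(j < N) complex.Re (xi j * conjc (eta j))))
          (limn (fun N => \sum_(j < N) complex.Im (xi j * conjc (eta j)))).

(* x belongs to S = L(s', s): linear on s', and continuous s' -> s, i.e.
   continuous on each step of the inductive limit s' = U_k {|.|'_k < oo}
   into each norm of the Frechet space s. *)
Definition is_op (x : op) : Prop :=
  (forall xi eta, in_s' xi -> in_s' eta ->
     x (fun j => xi j + eta j) = (fun j => x xi j + x eta j)) /\
  (forall (c : C) xi, in_s' xi ->
     x (fun j => c * xi j) = (fun j => c * x xi j)) /\
  (forall k n, exists c : R, forall xi, (dnorm k xi < +oo)%E ->
     (snorm n (x xi) <= c%:E * dnorm k xi)%E).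

Definition opadd (x y : op) : op := fun xi j => x xi j + y xi j.
Definition opscale (c : C) (x : op) : op := fun xi j => c * x xi j.
Definition opmul (x y : op) : op := fun xi => x (y xi).  (* x o iota o y *)
Definition opsum (m : nat) (f : nat -> op) : op :=
  fun xi j => \sum_(i < m) f i xi j.

Definition adj (x : op) : op :=
  epsilon (inhabits (fun _ _ => 0 : C))
    (fun xs : op => is_op xs /\
       forall xi eta, in_s' xi -> in_s' eta ->
         pairing (xs xi) eta = pairing xi (x eta)).

Definition opnorm (n : nat) (x : op) : \bar R :=
  ereal_sup [set snorm n (x xi) | xi in [set xi | (dnorm n xi <= 1)%E]].

Definition absq (x : op) : op :=
  opscale (2^-1) (opadd (opmul (adj x) x) (opmul x (adj x))).

Definition rcnorm (k m : nat) (xs : nat -> op) : \bar R :=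
  maxe (esqrt (opnorm k (opsum m (fun j => opmul (adj (xs j)) (xs j)))))
       (esqrt (opnorm k (opsum m (fun j => opmul (xs j) (adj (xs j)))))).

Definition all_op (m : nat) (xs : nat -> op) : Prop :=
  forall j, (j < m)%N -> is_op (xs j).

Definition is_bilin (u : op -> op -> C) : Prop :=
  forall (c : C) x x' y y', is_op x -> is_op x' -> is_op y -> is_op y' ->
    [/\ u (opadd x x') y = u x y + u x' y,
        u (opscale c x) y = c * u x y,
        u x (opadd y y') = u x y + u x y' &
        u x (opscale c y) = c * u x y].

Definition cont_bilin (u : op -> op -> C) : Prop :=
  exists n (c : R), forall x y, is_op x -> is_op y ->
    ((cabs (u x y))%:E <= c%:E * opnorm n x * opnorm n y)%E.

Definition bnorm (n : nat) (u : op -> op -> C) : \bar R :=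
  ereal_sup [set e | exists x y, [/\ is_op x, is_op y,
      (opnorm n x <= 1)%E, (opnorm n y <= 1)%E & e = (cabs (u x y))%:E]].

Definition is_lin (phi : op -> C) : Prop :=
  forall (c : C) x x', is_op x -> is_op x' ->
    phi (opadd x x') = phi x + phi x' /\ phi (opscale c x) = c * phi x.
Definition cont_fun (phi : op -> C) : Prop :=
  exists n (c : R), forall x, is_op x -> ((cabs (phi x))%:E <= c%:E * opnorm n x)%E.

Definition fnorm (n : nat) (phi : op -> C) : \bar R :=
  ereal_sup [set e | exists x, [/\ is_op x, (opnorm n x <= 1)%E &
      e = (cabs (phi x))%:E]].

(* Algebraic tensor product S (x) S: an element z is given by a
   representation z = sum_{j<m} xs j (x) ys j; two representations define
   the same tensor iff every bilinear form on S x S takes the same value on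
   them (universal property of the algebraic tensor product). *)
Definition tens_eq (m : nat) (xs ys : nat -> op)
    (m' : nat) (xs' ys' : nat -> op) : Prop :=
  forall B, is_bilin B ->
    \sum_(j < m) B (xs j) (ys j) = \sum_(j < m') B (xs' j) (ys' j).

Definition pinorm (n m : nat) (xs ys : nat -> op) : \bar R :=
  ereal_inf [set e | exists m' xs' ys', [/\ all_op m' xs', all_op m' ys',
     tens_eq m xs ys m' xs' ys' &
     e = (\sum_(j < m') opnorm n (xs' j) * opnorm n (ys' j))%E]].

Definition ahnorm (n m : nat) (xs ys : nat -> op) : \bar R :=
  ereal_inf [set e | exists m' xs' ys', [/\ all_op m' xs', all_op m' ys',
     tens_eq m xs ys m' xs' ys' &
     e = (esqrt (opnorm n (opsum m' (fun j => absq (xs' j)))) *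
          esqrt (opnorm n (opsum m' (fun j => absq (ys' j)))))%E]].

End NoncommutativeSchwartz.

(* Main.v *)
Require Import Defs.
From HB Require Import structures.
From mathcomp Require Import all_boot all_order all_algebra.
From mathcomp Require Import all_classical all_reals all_analysis.
From mathcomp Require Import complex.
From mathcomp Require Import ring lra zify.
From Stdlib Require Import ClassicalEpsilon.

(* Write x_kl for the matrix entries of x.  The operator norm ||x||_n is at most
   the Hilbert-Schmidt norm of (k^n l^n x_kl), and k^(2n) l^(2n) is at most
   (k^(4n) + l^(4n)) / 2, so ||x||_n^2 is controlled by the weighted row and
   column sums of |x_kl|^2.  After summation over the family x_j, these row and
   column sums are the diagonal entries of sum x_j x_j^* and sum x_j^* x_j, which
   are at most k^(-4n-2) times the (2n+1)-norm.  Hence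
   sum_j ||x_j||_n^2 <= (sum_k k^-2) (||(x_j)||_{2n+1}^rc)^2, and likewise with
   sum_j |x_j|^2 in place of the rc-norm; the Cauchy-Schwarz inequality in j then
   gives all three bounds with K = pi^2 / 6. *)

Set Implicit Arguments.
Unset Strict Implicit.
Unset Printing Implicit Defensive.

Import Order.TTheory GRing.Theory Num.Theory.
Import numFieldNormedType.Exports.
Local Open Scope classical_set_scope.
Local Open Scope ring_scope.

(** * The upper bound in the Basel problem *)

(** Squared moduli of matrix entries, unlike operator norms, can be added over the family and over
    both indices, and a diagonal entry of a sum of operators x_j^* x_j has no cancellation, so one
    test vector per index captures the whole family. The weight k^(2n) l^(2n) has to be separated
    because diagonal entries only see full rows or full columns; this doubles the index, and one
    further unit pays for the sum over k. What remains are means of a row sum and a column sum. They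
    suit both norms: a maximum dominates them, and they are exactly the diagonal entries of |x|^2.
    The obstacle is [adj], a choice made by [epsilon]: a matrix candidate must first be shown to be
    a continuous operator and an adjoint, and after that everything about x^* is read off the
    pairing. The bound on the partial sums of k^-2 comes from an exact finite sum of 1/sin^2. *)

Lemma sin_le_id (R : realType) (x : R) : 0 <= x -> sin x <= x.
Proof.
rewrite le_eqVlt => /predU1P[<-|x0]; first by rewrite sin0.
have [|c _] := @MVT R sin cos 0 x x0; first exact/continuous_subspaceT/continuous_sin.
by rewrite sin0 !subr0 => ->; rewrite ler_piMl ?cos_le1 ?ltW.
Qed.

(** Since sin(pi/2 - t) = cos t, adding the fractions gives 1 / (sin t cos t)^2, and sin t cos t is
    half of sin(2t). *)
Lemma sin_sqrV_split (R : realType) (t : R) : 0 < t < pi / 2 ->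
  (sin t ^+ 2)^-1 + (sin (pi / 2 - t) ^+ 2)^-1 = 4 * (sin (2 * t) ^+ 2)^-1.
Proof.
move=> t01; have st : 0 < sin t by apply: sin_gt0_pihalf.
have ct : 0 < cos t.
  by apply: cos_gt0_pihalf; move: t01 (@pi_gt0 R) => /andP[? ?] ?; lra.
have -> : sin (pi / 2 - t) = cos t.
  by rewrite addrC sinDpihalf cosN.
rewrite (mulr_natl t 2) sin_mulr2n mulr2n.
have h := cos2Dsin2 t.
have -> : (sin t ^+ 2)^-1 + (cos t ^+ 2)^-1 = (cos t ^+ 2 + sin t ^+ 2) * (sin t ^+ 2)^-1 *
  (cos t ^+ 2)^-1.
  by field; rewrite !gt_eqF.
by rewrite h mul1r -mulr2n -mulr_natl; field; rewrite !gt_eqF.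
Qed.

(* Each step of the induction pairs the angle t with pi/2 - t and doubles it; the
   recursion starts at 1/sin^2(pi/4) = 2.  With sin t <= t this bounds the sum of
   the inverse odd squares by pi^2/8. *)
Lemma sum_sin_sqrV (R : realType) (n : nat) :
  \sum_(0 <= k < 2 ^ n) (sin ((k.*2.+1)%:R / 2 ^+ n.+2 * pi : R) ^+ 2)^-1 = 2 * 4 ^+ n.
Proof.
elim: n => [|n IH].
  rewrite expn0 big_nat1 expr0 mulr1 /=.
  have p0 : 0 < (pi : R) / 4 < pi / 2 by move: (@pi_gt0 R) => ?; apply/andP; split; lra.
  have := sin_sqrV_split p0.
  have -> : (pi : R) / 2 - pi / 4 = pi / 4 by field.
  have -> : 2 * ((pi : R) / 4) = pi / 2 by field.
  rewrite sin_pihalf expr1n invr1.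
  have -> : (1%:R / 2 ^+ 2 * pi : R) = pi / 4 by rewrite expr2; field.
  by move=> h; lra.
rewrite (exprS 4) (mulrCA 2) -IH mulr_sumr.
rewrite (@big_cat_nat _ _ _ (2 ^ n)%N) //=; last by rewrite leq_exp2l.
(* The upper half is read backwards: the angles of [k] and [2 ^ n.+1 - 1 - k] add up to pi/2. *)
rewrite [X in _ + X](_ : _ =
  \sum_(0 <= k < 2 ^ n) (sin (pi / 2 - (k.*2.+1)%:R / 2 ^+ n.+3 * pi : R) ^+ 2)^-1); last first.
  rewrite [RHS]big_nat_rev /= -{1}[(2 ^ n)%N]add0n big_addn.
  have -> : (2 ^ n.+1 - 2 ^ n = 2 ^ n)%N by rewrite expnS; lia.
  apply: eq_big_nat => k /andP[_ kn]; congr ((sin _ ^+ 2)^-1).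
  have -> : ((0 + 2 ^ n - k.+1).*2.+1%:R : R) = 2 * 2 ^+ n - 2 * k%:R - 1.
    rewrite -addn1 natrD -muln2 natrM add0n natrB // natrX -addn1 natrD; ring.
  rewrite -addn1 natrD -muln2 natrM natrD natrX !exprS.
  by field; rewrite expf_eq0 /= pnatr_eq0 andbF.
rewrite -big_split /=; apply: eq_big_nat => k /andP[_ kn].
have p : 0 < (2 : R) ^+ n by rewrite exprn_gt0.
rewrite sin_sqrV_split.
  congr (_ * (sin _ ^+ 2)^-1); rewrite !exprS; field; by rewrite gt_eqF.
have pi0 := @pi_gt0 R.
apply/andP; split; first by rewrite !mulr_gt0 // invr_gt0 exprn_gt0.
rewrite [ltRHS]mulrC ltr_pM2r // !exprS ltr_pdivrMr ?mulr_gt0 //.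
have : (k.*2.+1)%:R < 2 * 2 ^+ n :> R.
  rewrite -natrX -natrM ltr_nat; lia.
by move=> h; lra.
Qed.

Lemma sum_odd_sqrV_le (R : realType) (n : nat) :
  \sum_(0 <= k < 2 ^ n) ((k.*2.+1)%:R ^+ 2)^-1 <= pi ^+ 2 / 8 :> R.
Proof.
have pi0 := @pi_gt0 R.
have p : 0 < (2 : R) ^+ n by rewrite exprn_gt0.
(* The factor is the square of [2 ^+ n.+2 / pi], so each term becomes 1/t^2 for the angle t
   occurring in [sum_sin_sqrV], and sin t <= t compares the two sums. *)
suff : 16 * 4 ^+ n / pi ^+ 2 * (\sum_(0 <= k < 2 ^ n) ((k.*2.+1)%:R ^+ 2)^-1) <= 2 * 4 ^+ n :> R.
  rewrite -ler_pdivlMl; last by rewrite divr_gt0 ?mulr_gt0 ?exprn_gt0.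
  move=> /le_trans; apply; rewrite le_eqVlt; apply/orP; left; apply/eqP.
  have q : 0 < (4 : R) ^+ n by rewrite exprn_gt0.
  by move: (pi : R) (4 ^+ n : R) pi0 q => a b a0 b0; field; rewrite !gt_eqF.
rewrite -sum_sin_sqrV mulr_sumr !big_seq; apply: ler_sum => k.
rewrite mem_index_iota => /andP[_ kn].
have k0 : 0 < (k.*2.+1)%:R :> R by rewrite ltr0n.
have t0 : 0 < (k.*2.+1)%:R / 2 ^+ n.+2 * pi :> R by rewrite !mulr_gt0 // invr_gt0 exprn_gt0.
have tp : (k.*2.+1)%:R / 2 ^+ n.+2 * pi < pi / 2 :> R.
  rewrite [ltRHS]mulrC ltr_pM2r // !exprS ltr_pdivrMr ?mulr_gt0 //.
  have : (k.*2.+1)%:R < 2 * 2 ^+ n :> R by rewrite -natrX -natrM ltr_nat; lia.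
  by move=> h; lra.
have s0 : 0 < sin ((k.*2.+1)%:R / 2 ^+ n.+2 * pi : R) by rewrite sin_gt0_pihalf ?t0.
apply: (@le_trans _ _ (((k.*2.+1)%:R / 2 ^+ n.+2 * pi) ^+ 2)^-1).
  rewrite (_ : 4 = 2 ^+ 2); last by rewrite -natrX.
  rewrite -exprM mulnC exprM le_eqVlt !exprS; apply/orP; left; apply/eqP.
  by move: (pi : R) pi0 {t0 tp s0} => a a0; field; rewrite !gt_eqF.
rewrite lef_pV2 ?posrE ?exprn_gt0 //.
by rewrite lerXn2r ?nnegrE ?(ltW s0) ?(ltW t0) // sin_le_id ?(ltW t0).
Qed.

(** Write S_M for the sum of the first M terms. The even terms of S_2M make up S_M / 4, so S_M <=
    S_2M <= pi^2/8 + S_M / 4, that is S_M <= pi^2/6. This is applied to M = 2^N, where the odd part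
    is controlled, and S_N <= S_M because N <= 2^N. *)
Lemma sum_sqrV_le (R : realType) (N : nat) :
  \sum_(0 <= k < N) ((k.+1)%:R ^+ 2)^-1 <= pi ^+ 2 / 6 :> R.
Proof.
pose f k : R := (k.+1%:R ^+ 2)^-1.
have f0 k : 0 <= f k by rewrite invr_ge0 exprn_ge0.
have mono a b : (a <= b)%N -> \sum_(0 <= k < a) f k <= \sum_(0 <= k < b) f k.
  move=> ab; rewrite [leRHS](big_cat_nat _ ab) //= lerDl.
  by apply: sumr_ge0.
have split2 m : \sum_(0 <= k < m.*2) f k =
    \sum_(0 <= k < m) ((k.*2.+1)%:R ^+ 2)^-1 + 4^-1 * \sum_(0 <= k < m) f k.
  elim: m => [|m IH]; first by rewrite !big_nil mulr0 addr0.
  rewrite doubleS !big_nat_recr //= IH /f mulrDr.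
  have -> : (m.*2.+2%:R : R) = 2 * m.+1%:R by rewrite -doubleS -muln2 natrM mulrC.
  have h : (m.+1%:R : R) != 0 by rewrite pnatr_eq0.
  have h' : (m.*2.+1%:R : R) != 0 by rewrite pnatr_eq0.
  have -> : ((2 * m.+1%:R) ^+ 2 : R)^-1 = 4^-1 * (m.+1%:R ^+ 2)^-1.
    by rewrite exprMn invfM [2 ^+ 2](_ : _ = 4) // -natrX.
  ring.
have hN : (N <= 2 ^ N)%N by apply: ltnW; exact: ltn_expl.
apply: (le_trans (mono _ _ hN)).
have := split2 (2 ^ N)%N; have := mono (2 ^ N)%N (2 ^ N).*2 ltac:(lia).
have := sum_odd_sqrV_le R N.
by move=> h1 h2 h3; lra.
Qed.

(** * Convergence of complex sequences *)

Section CauchySchwarz.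
Variables (R : realFieldType) (I : Type).

Lemma sum_cauchy_schwarz (r : seq I) (f g : I -> R) :
  (\sum_(i <- r) f i * g i) ^+ 2 <= (\sum_(i <- r) f i ^+ 2) * (\sum_(i <- r) g i ^+ 2).
Proof.
elim: r => [|i r IH]; first by rewrite !big_nil expr0n mulr0.
rewrite !big_cons.
have A0 : 0 <= \sum_(i <- r) f i ^+ 2 by apply: sumr_ge0 => ? _; rewrite sqr_ge0.
have B0 : 0 <= \sum_(i <- r) g i ^+ 2 by apply: sumr_ge0 => ? _; rewrite sqr_ge0.
move: (\sum_(i <- r) f i * g i) (\sum_(i <- r) f i ^+ 2) (\sum_(i <- r) g i ^+ 2) IH A0 B0 (f
  i) (g i).
move=> S A B h A0 B0 a b.
(* This is the cross term of the induction step. If it failed, squaring would contradict S^2 <= A B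
   together with 4 A B a^2 b^2 <= (A b^2 + B a^2)^2. *)
suff : 2 * S * (a * b) <= A * b ^+ 2 + B * a ^+ 2 by nra.
have [//|lt] := leP (2 * S * (a * b)) (A * b ^+ 2 + B * a ^+ 2).
have P0 : 0 <= A * b ^+ 2 + B * a ^+ 2 by rewrite addr_ge0 // mulr_ge0 // sqr_ge0.
have : (A * b ^+ 2 + B * a ^+ 2) ^+ 2 < (2 * S * (a * b)) ^+ 2 by rewrite ltr_pXn2r // ?nnegrE
  // (le_trans P0) // ltW.
have h1 : S ^+ 2 * (a * b) ^+ 2 <= A * B * (a * b) ^+ 2 by rewrite ler_wpM2r // sqr_ge0.
have h2 := sqr_ge0 (A * b ^+ 2 - B * a ^+ 2).
by lra.
Qed.
End CauchySchwarz.

(** * Moduli and limits of complex numbers *)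

Section Complex.
Variable R : realType.
Local Notation C := R[i].
Implicit Types (z : C).

Lemma cabsE z : cabs z = ComplexField.Normc.normc z.
Proof. by case: z. Qed.

Lemma cabs_ge0 z : 0 <= cabs z.
Proof. exact: sqrtr_ge0. Qed.

Lemma cabs_sqr z : cabs z ^+ 2 = complex.Re z ^+ 2 + complex.Im z ^+ 2.
Proof. by rewrite sqr_sqrtr // addr_ge0 ?sqr_ge0. Qed.

Lemma cabs0 : cabs (0 : C) = 0.
Proof. by rewrite /cabs /= expr0n addr0 sqrtr0. Qed.

Lemma cabsM z z' : cabs (z * z') = cabs z * cabs z'.
Proof. by rewrite !cabsE ComplexField.Normc.normcM. Qed.

Lemma cabsJ z : cabs (conjc z) = cabs z.
Proof. by case: z => a b; rewrite /cabs /= sqrrN. Qed.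

Lemma cabsD z z' : cabs (z + z') <= cabs z + cabs z'.
Proof. rewrite !cabsE; exact: le_normcD. Qed.

Lemma cabs_real (r : R) : cabs (r%:C)%C = `|r|.
Proof. by rewrite /cabs /= expr0n addr0 sqrtr_sqr. Qed.

Lemma cabs_sum (I : Type) (r : seq I) (f : I -> C) :
  cabs (\sum_(i <- r) f i) <= \sum_(i <- r) cabs (f i).
Proof.
apply: (big_ind2 (fun a b => cabs a <= b)) => //; first by rewrite cabs0.
by move=> a b c d h h'; apply: (le_trans (cabsD _ _)); rewrite lerD.
Qed.

Lemma Re_sum (I : Type) (r : seq I) (f : I -> C) :
  complex.Re (\sum_(i <- r) f i) = \sum_(i <- r) complex.Re (f i).
Proof. by apply: (big_morph (@complex.Re R)) => // -[? ?] [? ?]. Qed.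

Lemma Im_sum (I : Type) (r : seq I) (f : I -> C) :
  complex.Im (\sum_(i <- r) f i) = \sum_(i <- r) complex.Im (f i).
Proof. by apply: (big_morph (@complex.Im R)) => // -[? ?] [? ?]. Qed.

Lemma normRe_le_cabs z : `|complex.Re z| <= cabs z.
Proof.
by rewrite -[leLHS]sqrtr_sqr ler_sqrt ?addr_ge0 ?sqr_ge0 // lerDl sqr_ge0.
Qed.

Lemma normIm_le_cabs z : `|complex.Im z| <= cabs z.
Proof.
by rewrite -[leLHS]sqrtr_sqr ler_sqrt ?addr_ge0 ?sqr_ge0 // lerDr sqr_ge0.
Qed.

(** Componentwise convergence matches [pairing], which takes the limits of the real and imaginary
    parts separately. *)
Definition ccvg (z : nat -> C) (l : C) :=
  (fun N => complex.Re (z N)) @ \oo --> complex.Re l /\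
  (fun N => complex.Im (z N)) @ \oo --> complex.Im l.

Lemma ccvgD (u v : nat -> C) l l' :
  ccvg u l -> ccvg v l' -> ccvg (fun N => u N + v N) (l + l').
Proof.
move=> [ur ui] [vr vi]; split.
  rewrite (_ : (fun N => complex.Re (u N + v N)) = (fun N => complex.Re (u N)) \+ (fun N =>
    complex.Re (v N))).
    rewrite (_ : complex.Re (l + l') = complex.Re l + complex.Re l'); last by case: l {ur ui};
      case: l' {vr vi}.
    exact: cvgD.
  by apply/funext => N /=; case: (u N); case: (v N).
rewrite (_ : (fun N => complex.Im (u N + v N)) = (fun N => complex.Im (u N)) \+ (fun N =>
  complex.Im (v N))).
  rewrite (_ : complex.Im (l + l') = complex.Im l + complex.Im l'); last by case: l {ur ui};
    case: l' {vr vi}.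
  exact: cvgD.
by apply/funext => N /=; case: (u N); case: (v N).
Qed.

Lemma ccvgZ (c : C) (u : nat -> C) l : ccvg u l -> ccvg (fun N => c * u N) (c * l).
Proof.
case: c => a b [ur ui]; split.
  rewrite (_ : (fun N => _) = (fun N => a * complex.Re (u N) - b * complex.Im (u N))).
    rewrite (_ : complex.Re _ = a * complex.Re l - b * complex.Im l); last by case: l {ur ui}.
    by apply: cvgB; apply: cvgMr.
  by apply/funext => N /=; case: (u N).
rewrite (_ : (fun N => _) = (fun N => a * complex.Im (u N) + b * complex.Re (u N))).
  rewrite (_ : complex.Im _ = a * complex.Im l + b * complex.Re l); last by case: l {ur ui}.
  by apply: cvgD; apply: cvgMr.
by apply/funext => N /=; case: (u N).
Qed.

Lemma ccvg_near_cst (u : nat -> C) l M :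
  (forall N, (M <= N)%N -> u N = l) -> ccvg u l.
Proof.
move=> h; split; apply: cvg_near_cst; exists M => // N /= /h -> //.
Qed.

Lemma ccvg_dist0 (u : nat -> C) l :
  (fun N => cabs (u N - l)) @ \oo --> 0 -> ccvg u l.
Proof.
have key (f : nat -> R) a : (forall N, `|f N - a| <= cabs (u N - l)) ->
    (fun N => cabs (u N - l)) @ \oo --> 0 -> f @ \oo --> a.
  move=> fa h; apply/cvgrPdist_le => e e0.
  move/cvgr0Pnorm_le : h => /(_ e e0) [M _ hM].
  exists M => // N /= /hM; rewrite ger0_norm ?cabs_ge0 // distrC.
  exact: le_trans.
move=> h; split; apply: key h => N.
  apply: le_trans (normRe_le_cabs _).
  by case: (u N) => a b; case: l => c d.
apply: le_trans (normIm_le_cabs _).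
by case: (u N) => a b; case: l => c d.
Qed.

Lemma ccvg_cabs_sqr_le (u : nat -> C) l (c : R) :
  ccvg u l -> (forall N, cabs (u N) ^+ 2 <= c) -> cabs l ^+ 2 <= c.
Proof.
move=> [ur ui] h.
have cv : (fun N => cabs (u N) ^+ 2) @ \oo --> cabs l ^+ 2.
  rewrite cabs_sqr (_ : (fun N => _) = (fun N => complex.Re (u N) * complex.Re (u N) +
    complex.Im (u N) * complex.Im (u N))).
    by rewrite !expr2; apply: cvgD; apply: cvgM.
  by apply/funext => N; rewrite cabs_sqr !expr2.
rewrite -(cvg_lim _ cv) //; apply: limr_le; first by apply/cvg_ex; exists (cabs l ^+ 2).
by apply: nearW.
Qed.

End Complex.

(** * Weighted square sums and the pairing *)

Section WeightedSums.
Variable R : realType.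
Local Notation C := R[i].
Implicit Types (xi eta : cseq R) (w : nat -> R).

Lemma esqrtE (e : \bar R) : esqrt e = sqrte e.
Proof. by case: e. Qed.

(** With weights [wt n] and [wtV n] this is the square of [snorm n] and of [dnorm n]; with constant
    weight 1 it measures the rows and columns of a matrix. *)
Definition wsum w xi : \bar R := (\sum_(j <oo) (cabs (xi j) ^+ 2 * w j)%:E)%E.
Definition wt n (j : nat) : R := (j.+1)%:R ^+ (2 * n).
Definition wtV n (j : nat) : R := (wt n j)^-1.

Lemma snormE n xi : snorm n xi = sqrte (wsum (wt n) xi).
Proof. by rewrite -esqrtE. Qed.

Lemma dnormE n xi : dnorm n xi = sqrte (wsum (wtV n) xi).
Proof. by rewrite -esqrtE. Qed.

Lemma wt_gt0 n j : 0 < wt n j.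
Proof. by rewrite exprn_gt0. Qed.

Lemma wt_ge1 n j : 1 <= wt n j.
Proof. by rewrite exprn_ege1 // ler1n. Qed.

Lemma wtV_gt0 n j : 0 < wtV n j.
Proof. by rewrite invr_gt0 wt_gt0. Qed.

Lemma wterm_ge0 w xi j : (forall j, 0 < w j) -> (0 <= (cabs (xi j) ^+ 2 * w j)%:E)%E.
Proof. by move=> w0; rewrite lee_fin mulr_ge0 ?sqr_ge0 ?ltW. Qed.

Lemma wsum_ge0 w xi : (forall j, 0 < w j) -> (0 <= wsum w xi)%E.
Proof. by move=> w0; apply: nneseries_ge0 => j _ _; exact: wterm_ge0. Qed.

Lemma wsum_partial_le w xi N : (forall j, 0 < w j) ->
  ((\sum_(j < N) cabs (xi j) ^+ 2 * w j)%:E <= wsum w xi)%E.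
Proof.
move=> w0; rewrite -(big_mkord xpredT (fun j => cabs (xi j) ^+ 2 * w j)) -sumEFin.
by apply: nneseries_lim_ge => j _ _; exact: wterm_ge0.
Qed.

Lemma wsum_term_le w xi k : (forall j, 0 < w j) ->
  ((cabs (xi k) ^+ 2 * w k)%:E <= wsum w xi)%E.
Proof.
move=> w0; apply: le_trans (wsum_partial_le xi k.+1 w0).
rewrite lee_fin big_ord_recr /= lerDr.
by apply: sumr_ge0 => j _; rewrite mulr_ge0 ?sqr_ge0 ?ltW.
Qed.

Lemma wsumZ w xi c : (forall j, 0 < w j) ->
  wsum w (fun j => c * xi j) = ((cabs c ^+ 2)%:E * wsum w xi)%E.
Proof.
move=> w0; rewrite /wsum -nneseriesZl; last by move=> j _; exact: wterm_ge0.
by apply: eq_eseriesr => j _; rewrite cabsM exprMn -mulrA EFinM.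
Qed.

Lemma wsum_le w w' xi eta : (forall j, 0 < w j) ->
  (forall j, cabs (xi j) ^+ 2 * w j <= cabs (eta j) ^+ 2 * w' j) ->
  (wsum w xi <= wsum w' eta)%E.
Proof.
move=> w0 h; apply: lee_nneseries => j _; first by move=> _; exact: wterm_ge0.
by rewrite lee_fin.
Qed.

(** * Multiples of basis vectors, truncations and tails *)

Definition delta (c : C) (k : nat) : cseq R := fun j => if j == k then c else 0.

Lemma wsum_delta w c k : (forall j, 0 < w j) ->
  wsum w (delta c k) = (cabs c ^+ 2 * w k)%:E.
Proof.
move=> w0; rewrite /wsum (@nneseriesD1 _ _ k) //; last by move=> j _; exact: wterm_ge0.
rewrite {1}/delta eqxx eseries0 ?adde0 // => j _ /= /negPf jk.
by rewrite /delta jk cabs0 expr0n mul0r.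
Qed.

Definition trunc N xi : cseq R := fun j => if (j < N)%N then xi j else 0.
Definition tail N xi : cseq R := fun j => if (j < N)%N then 0 else xi j.

Lemma trunc_tail N xi : (fun j => trunc N xi j + tail N xi j) = xi.
Proof. by apply/funext => j; rewrite /trunc /tail; case: ifP; rewrite ?addr0 ?add0r. Qed.

Lemma truncS N xi :
  trunc N.+1 xi = (fun j => trunc N xi j + xi N * delta 1 N j).
Proof.
apply/funext => j; rewrite /trunc /delta ltnS leq_eqVlt.
by case: eqVneq => [->|_] /=; rewrite ?ltnn ?add0r ?mulr1 ?mulr0 ?addr0.
Qed.

Lemma wsum_trunc_le w xi N : (forall j, 0 < w j) -> (wsum w (trunc N xi) <= wsum w xi)%E.
Proof.
move=> w0; apply: wsum_le => // j; apply: ler_wpM2r; first exact: ltW.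
rewrite /trunc.
by case: ifP => // _; rewrite cabs0 expr0n sqr_ge0.
Qed.

Lemma wsum_tail_le w xi N : (forall j, 0 < w j) -> (wsum w (tail N xi) <= wsum w xi)%E.
Proof.
move=> w0; apply: wsum_le => // j; apply: ler_wpM2r; first exact: ltW.
rewrite /tail.
by case: ifP => // _; rewrite cabs0 expr0n sqr_ge0.
Qed.

Lemma wsum_tail_cvg0 w xi : (forall j, 0 < w j) -> (wsum w xi < +oo)%E ->
  (fun N => wsum w (tail N xi)) @ \oo --> 0%E.
Proof.
move=> w0 fin.
rewrite (_ : (fun N => _) = fun N => (\sum_(N <= j <oo) (cabs (xi j) ^+ 2 * w j)%:E)%E).
  by apply: nneseries_tail_cvg => // j _; exact: wterm_ge0.
apply/funext => N; rewrite [RHS]eseries_cond [RHS]eseries_mkcond.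
apply: eq_eseriesr => j _; rewrite /tail /=; case: leqP => // _.
by rewrite cabs0 expr0n mul0r.
Qed.

(** The [limn] in [pairing] is informative only once convergence is known. Splitting |a_j b_j| as
    (|a_j| sqrt w_j) (|b_j| / sqrt w_j), Cauchy-Schwarz bounds the partial sums of moduli by sqrt(A
    B). This gives absolute convergence, and the bound passes to the limit. *)
Lemma pairing_prop w (a b : cseq R) (A B : R) : (forall j, 0 < w j) ->
  (wsum w a <= A%:E)%E -> (wsum (fun j => (w j)^-1)%R b <= B%:E)%E ->
  ccvg (fun N => \sum_(j < N) a j * conjc (b j)) (pairing a b) /\
  cabs (pairing a b) ^+ 2 <= A * B.
Proof.
move=> w0 hA hB.
have wV0 j : 0 < (w j)^-1 by rewrite invr_gt0.
have A0 : 0 <= A by rewrite -lee_fin (le_trans _ hA) // wsum_ge0.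
have B0 : 0 <= B by rewrite -lee_fin (le_trans _ hB) // wsum_ge0.
have cs N : (\sum_(j < N) cabs (a j * conjc (b j))) ^+ 2 <= A * B.
  have : (\sum_(j < N) (cabs (a j) * Num.sqrt (w j)) * (cabs (b j) * (Num.sqrt (w j))^-1)) ^+ 2
    <= A * B.
    apply: (le_trans (sum_cauchy_schwarz _ _ _)).
    apply: ler_pM; try by apply: sumr_ge0 => *; rewrite sqr_ge0.
      rewrite -lee_fin; apply: le_trans hA; apply: le_trans (wsum_partial_le a N w0).
      by rewrite lee_fin; apply: ler_sum => j _; rewrite exprMn (sqr_sqrtr (ltW (w0 j))).
    rewrite -lee_fin; apply: le_trans hB; apply: le_trans (wsum_partial_le b N wV0).
    by rewrite lee_fin; apply: ler_sum => j _; rewrite exprMn exprVn (sqr_sqrtr (ltW (w0 j))).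
  rewrite (eq_bigr (fun j : 'I_N => cabs (a j * conjc (b j)))) // => j _.
  rewrite cabsM cabsJ mulrACA divff ?mulr1 //.
  by rewrite gt_eqF // sqrtr_gt0.
have ubd N : \sum_(j < N) cabs (a j * conjc (b j)) <= Num.sqrt (A * B).
  apply: le_trans (ler_norm _) _; rewrite -sqrtr_sqr.
  by rewrite (@ler_sqrt _ _ (A * B)) ?cs // mulr_ge0.
have cv (f : C -> R) : (forall z, `|f z| <= cabs z) ->
    cvgn (fun N => \sum_(j < N) f (a j * conjc (b j))).
  move=> hf.
  rewrite (_ : (fun N => _) = series (fun j => f (a j * conjc (b j)))); last first.
    by rewrite seriesEord.
  apply: normed_cvg; apply: nondecreasing_is_cvgn.
    apply/nondecreasing_seqP => N; rewrite /= /series /= big_nat_recr //= lerDl.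
    exact: normr_ge0.
  exists (Num.sqrt (A * B)) => _ [N _ <-]; rewrite /= seriesEord /=.
  by apply: le_trans (ubd N); apply: ler_sum => j _.
have h : ccvg (fun N => \sum_(j < N) a j * conjc (b j)) (pairing a b).
  split; rewrite /pairing /=.
    by under eq_fun do rewrite Re_sum; apply: cv; exact: normRe_le_cabs.
  by under eq_fun do rewrite Im_sum; apply: cv; exact: normIm_le_cabs.
split=> //; apply: (ccvg_cabs_sqr_le h) => N.
apply: le_trans (cs N); rewrite ler_sqr ?nnegrE ?cabs_ge0 ?cabs_sum //.
by apply: sumr_ge0 => *; exact: cabs_ge0.
Qed.

Lemma pairing_eq (a b : cseq R) l :
  ccvg (fun N => \sum_(j < N) a j * conjc (b j)) l -> pairing a b = l.
Proof.
case: l => p q [/= hr hi]; rewrite /pairing; congr Complex.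
  by apply/cvg_lim => //; move: hr; under eq_fun do rewrite Re_sum.
by apply/cvg_lim => //; move: hi; under eq_fun do rewrite Im_sum.
Qed.

Lemma pairing_deltar (a : cseq R) k : pairing a (delta 1 k) = a k.
Proof.
apply: pairing_eq; apply: (@ccvg_near_cst _ _ _ k.+1) => N kN.
rewrite (bigD1 (Ordinal kN)) //= {1}/delta eqxx conjc1 mulr1 big1 ?addr0 // => j /negPf jk.
by rewrite /delta (_ : (j == k :> nat) = false) ?conjc0 ?mulr0 //; rewrite -jk.
Qed.

Lemma pairing_deltal (b : cseq R) k : pairing (delta 1 k) b = conjc (b k).
Proof.
apply: pairing_eq; apply: (@ccvg_near_cst _ _ _ k.+1) => N kN.
rewrite (bigD1 (Ordinal kN)) //= {1}/delta eqxx mul1r big1 ?addr0 // => j /negPf jk.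
by rewrite /delta (_ : (j == k :> nat) = false) ?mul0r //; rewrite -jk.
Qed.

Lemma pairing_self (a : cseq R) : wsum (fun=> 1) a \is a fin_num ->
  pairing a a = ((fine (wsum (fun=> 1) a))%:C)%C.
Proof.
move=> fin; apply: pairing_eq.
have hz (z : C) : z * conjc z = (cabs z ^+ 2)%:C%C.
  by case: z => p q; rewrite cabs_sqr /=; simpc; congr Complex; rewrite /=; ring.
have E N : \sum_(j < N) a j * conjc (a j) = ((\sum_(j < N) cabs (a j) ^+ 2)%:C)%C.
  by rewrite rmorph_sum /=; apply: eq_bigr => j _; rewrite hz.
under eq_fun do rewrite E.
split; last exact: cvg_cst.
move: (fin) => /fineK/esym; rewrite {1}/wsum => hf.
have : (fun n => \sum_(0 <= j < n) (cabs (a j) ^+ 2 * 1)%:E)%E @ \oo --> (fine (wsum (fun=> 1)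
  a))%:E.
  by rewrite -hf; apply: is_cvg_nneseries => j _ _; exact: (@wterm_ge0 (fun=> 1)).
move=> /fine_cvg; apply: cvg_trans; apply: near_eq_cvg; near=> n => /=.
rewrite sumEFin /= big_mkord; by apply: eq_bigr => j _; rewrite mulr1.
Unshelve. all: by end_near.
Qed.

End WeightedSums.

(** * Adjoints *)

Section Operators.
Variable R : realType.
Local Notation C := R[i].
Implicit Types (xi eta zeta : cseq R) (w : nat -> R) (x : op R).

Lemma pairing_fin w xi eta : (forall j, 0 < w j) ->
  (wsum w xi < +oo)%E -> (wsum (fun j => (w j)^-1)%R eta < +oo)%E ->
  ccvg (fun N => \sum_(j < N) xi j * conjc (eta j)) (pairing xi eta) /\
  ((cabs (pairing xi eta) ^+ 2)%:E <= wsum w xi * wsum (fun j => (w j)^-1)%R eta)%E.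
Proof.
move=> w0; have wV0 j : 0 < (w j)^-1 by rewrite invr_gt0.
have := wsum_ge0 xi w0; have := wsum_ge0 eta wV0.
have := @pairing_prop R w xi eta.
case: (wsum w xi) => [a| |] //; case: (wsum _ eta) => [b| |] // h _ _ _ _.
by have [h1 h2] := h _ _ w0 (lexx _) (lexx _); split; rewrite // -EFinM lee_fin.
Qed.

Lemma wtVV n : (fun j => (@wtV R n j)^-1) = wt R n.
Proof. by apply/funext => j; rewrite /wtV invrK. Qed.

Lemma pairing_dual_s k xi zeta :
  (wsum (wtV R k) xi < +oo)%E -> (wsum (wt R k) zeta < +oo)%E ->
  ccvg (fun N => \sum_(j < N) xi j * conjc (zeta j)) (pairing xi zeta) /\
  ((cabs (pairing xi zeta) ^+ 2)%:E <= wsum (wtV R k) xi * wsum (wt R k) zeta)%E.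
Proof.
by move=> h1 h2; have := @pairing_fin (wtV R k) xi zeta (@wtV_gt0 _ k); rewrite wtVV; apply.
Qed.

Lemma sqrte_lty (e : \bar R) : (sqrte e < +oo)%E = (e < +oo)%E.
Proof. by case: e => [r| |] //=; rewrite !ltry. Qed.

Lemma in_s'P xi : in_s' xi <-> exists n, (wsum (wtV R n) xi < +oo)%E.
Proof. by split=> -[n h]; exists n; move: h; rewrite dnormE sqrte_lty. Qed.

Lemma in_s_in_s' n xi : (wsum (wt R n) xi < +oo)%E -> in_s' xi.
Proof.
move=> h; apply/in_s'P; exists n; apply: le_lt_trans h.
apply: wsum_le => j; first exact: wtV_gt0.
rewrite ler_wpM2l ?sqr_ge0 // (@le_trans _ _ 1) ?wt_ge1 //.
by rewrite invf_le1 ?wt_gt0 // wt_ge1.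
Qed.

Lemma in_s'_delta c k : in_s' (delta c k : cseq R).
Proof.
by apply/in_s'P; exists 0%N; rewrite wsum_delta ?ltry // => j; exact: wtV_gt0.
Qed.

(** Continuity in squared form, where weighted sums can be used without roots; squaring also makes
    the constant non-negative. *)
Lemma op_bound x : is_op x -> forall k n, exists2 c : R, 0 <= c & forall xi,
  (wsum (wtV R k) xi < +oo)%E -> (wsum (wt R n) (x xi) <= c%:E * wsum (wtV R k) xi)%E.
Proof.
move=> [_ [_ h]] k n; have [c hc] := h k n; exists (c ^+ 2); first exact: sqr_ge0.
move=> xi fin; have := hc xi; rewrite snormE dnormE sqrte_lty => /(_ fin).
have := wsum_ge0 xi (@wtV_gt0 R k); have := wsum_ge0 (x xi) (@wt_gt0 R n).
move: fin; case: (wsum (wtV R k) xi) => [d| |] //; case: (wsum _ (x xi)) => [s| |] //=.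
rewrite -!EFinM !lee_fin => _ s0 d0 hh.
rewrite -(sqr_sqrtr s0) -(sqr_sqrtr d0) -exprMn.
by rewrite ler_pXn2r ?nnegrE ?sqrtr_ge0 // (le_trans _ hh) ?sqrtr_ge0.
Qed.

Lemma op_boundP x :
  (forall xi eta, in_s' xi -> in_s' eta ->
     x (fun j => xi j + eta j) = (fun j => x xi j + x eta j)) ->
  (forall (c : C) xi, in_s' xi -> x (fun j => c * xi j) = (fun j => c * x xi j)) ->
  (forall k n, exists2 c : R, 0 <= c & forall xi,
  (wsum (wtV R k) xi < +oo)%E -> (wsum (wt R n) (x xi) <= c%:E * wsum (wtV R k) xi)%E) ->
  is_op x.
Proof.
move=> hD hZ h; split=> //; split=> // k n; have [c c0 hc] := h k n.
exists (Num.sqrt c) => xi; rewrite snormE dnormE sqrte_lty => /hc.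
have d0 := wsum_ge0 xi (@wtV_gt0 R k).
rewrite -lee_sqrt; last by rewrite mule_ge0 ?lee_fin.
by rewrite sqrteM ?lee_fin.
Qed.

Lemma op_fin x k xi n : is_op x -> (wsum (wtV R k) xi < +oo)%E -> (wsum (wt R n) (x xi) < +oo)%E.
Proof.
move=> ox fin; have [c c0 hc] := op_bound ox k n.
apply: le_lt_trans (hc _ fin) _.
by rewrite lte_mul_pinfty ?lee_fin.
Qed.

Lemma op_in_s x xi n : is_op x -> in_s' xi -> (wsum (wt R n) (x xi) < +oo)%E.
Proof. by move=> ox /in_s'P[k h]; exact: op_fin ox h. Qed.

Lemma op_in_s' x xi : is_op x -> in_s' xi -> in_s' (x xi).
Proof. by move=> ox h; apply: (@in_s_in_s' 0); exact: op_in_s. Qed.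

Lemma in_s'Z c xi : in_s' xi -> in_s' (fun j => c * xi j).
Proof.
move=> /in_s'P[k h]; apply/in_s'P; exists k.
by rewrite wsumZ ?lte_mul_pinfty ?lee_fin ?sqr_ge0 // => j; exact: wtV_gt0.
Qed.

Lemma in_s'_trunc N xi : in_s' xi -> in_s' (trunc N xi).
Proof.
move=> /in_s'P[k h]; apply/in_s'P; exists k; apply: le_lt_trans h.
by apply: wsum_trunc_le => j; exact: wtV_gt0.
Qed.

Lemma in_s'_tail N xi : in_s' xi -> in_s' (tail N xi).
Proof.
move=> /in_s'P[k h]; apply/in_s'P; exists k; apply: le_lt_trans h.
by apply: wsum_tail_le => j; exact: wtV_gt0.
Qed.

Lemma op_delta x c k : is_op x -> x (delta c k) = fun j => c * x (delta 1 k) j.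
Proof.
move=> [_ [h _]]; rewrite -h; last exact: in_s'_delta.
by congr x; apply/funext => j; rewrite /delta; case: ifP; rewrite ?mulr1 ?mulr0.
Qed.

Lemma pairingDZr xi zeta zeta' c : in_s' xi ->
  (forall n, (wsum (wt R n) zeta < +oo)%E) -> (forall n, (wsum (wt R n) zeta' < +oo)%E) ->
  pairing xi (fun j => zeta j + c * zeta' j) = pairing xi zeta + conjc c * pairing xi zeta'.
Proof.
move=> /in_s'P[k hk] h h'; apply: pairing_eq.
have [c1 _] := pairing_dual_s hk (h k); have [c2 _] := pairing_dual_s hk (h' k).
have := ccvgD c1 (ccvgZ (conjc c) c2).
rewrite (_ : (fun N => _) = (fun N : nat => \sum_(j < N) xi j * conjc (zeta j + c * zeta' j))) //.
apply/funext => N; rewrite mulr_sumr -big_split /=; apply: eq_bigr => j _.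
by rewrite rmorphD rmorphM /= mulrDr mulrCA.
Qed.

Lemma pairingDl xi xi' zeta : in_s' xi -> in_s' xi' ->
  (forall n, (wsum (wt R n) zeta < +oo)%E) ->
  pairing (fun j => xi j + xi' j) zeta = pairing xi zeta + pairing xi' zeta.
Proof.
move=> /in_s'P[k hk] /in_s'P[k' hk'] h; apply: pairing_eq.
have [c1 _] := pairing_dual_s hk (h k); have [c2 _] := pairing_dual_s hk' (h k').
have := ccvgD c1 c2.
rewrite (_ : (fun N => _) = (fun N : nat => \sum_(j < N) (xi j + xi' j) * conjc (zeta j))) //.
by apply/funext => N; rewrite -big_split /=; apply: eq_bigr => j _; rewrite mulrDl.
Qed.

Lemma pairingZl xi zeta c : in_s' xi ->
  (forall n, (wsum (wt R n) zeta < +oo)%E) ->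
  pairing (fun j => c * xi j) zeta = c * pairing xi zeta.
Proof.
move=> /in_s'P[k hk] h; apply: pairing_eq.
have [c1 _] := pairing_dual_s hk (h k).
have := ccvgZ c c1.
rewrite (_ : (fun N => _) = (fun N : nat => \sum_(j < N) (c * xi j) * conjc (zeta j))) //.
by apply/funext => N; rewrite mulr_sumr; apply: eq_bigr => j _; rewrite mulrA.
Qed.

(* <x^* xi, e_i> = <xi, x e_i> forces this formula. *)
Definition adjfun x : op R := fun xi i => pairing xi (x (delta 1 i)).

Lemma wtVS n j : wtV R n.+1 j * wt R n j = (j.+1%:R ^+ 2)^-1.
Proof.
have j0 : (j.+1%:R : R) != 0 by rewrite pnatr_eq0.
by rewrite /wtV /wt mulnS exprD invfM -mulrA mulVf ?mulr1 //.
Qed.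

Lemma nneseries_sqrV_le : (\sum_(j <oo) ((j.+1%:R ^+ 2)^-1 : R)%:E <= (pi ^+ 2 / 6 : R)%:E)%E.
Proof.
apply: lime_le; first by apply: is_cvg_nneseries => j _ _; rewrite lee_fin invr_ge0 sqr_ge0.
by apply: nearW => N; rewrite sumEFin lee_fin sum_sqrV_le.
Qed.

(** Cauchy-Schwarz bounds |<xi, x e_i>|^2 by the squared dual k-norm of xi times the squared k-norm
    of x e_i. Continuity of x from step n+1 into the k-norm makes the latter at most c i^(-2n-2), so
    the weight i^(2n) leaves the summable i^-2. *)
Lemma adjfun_is_op x : is_op x -> is_op (adjfun x).
Proof.
move=> ox; have fx i n : (wsum (wt R n) (x (delta 1%R i)) < +oo)%E.
  by apply: op_in_s => //; exact: in_s'_delta.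
apply: op_boundP.
- by move=> xi eta h h'; apply/funext => i; rewrite /adjfun pairingDl.
- by move=> c xi h; apply/funext => i; rewrite /adjfun pairingZl.
move=> k n; have [c c0 hc] := op_bound ox n.+1 k.
have P0 : 0 <= pi ^+ 2 / 6 :> R by rewrite divr_ge0 ?sqr_ge0.
exists (c * (pi ^+ 2 / 6)); first exact: mulr_ge0.
move=> xi fin.
have D0 := wsum_ge0 xi (@wtV_gt0 R k).
apply: (@le_trans _ _ (\sum_(j <oo) (wsum (wtV R k) xi * c%:E) * ((j.+1%:R ^+ 2)^-1)%:E)%E).
  apply: lee_nneseries => j _; first by move=> _; apply: wterm_ge0; exact: wt_gt0.
  have [_ h] := pairing_dual_s fin (fx j k).
  rewrite -(wtVS n) !EFinM muleA.
  apply: lee_wpmul2r; first by rewrite lee_fin ltW ?wt_gt0.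
  apply: (le_trans h); rewrite -muleA; apply: lee_wpmul2l => //.
  have := hc (delta 1 j); rewrite wsum_delta; last exact: wtV_gt0.
  by rewrite cabsE ComplexField.Normc.normc1 expr1n mul1r; apply; rewrite ltry.
move: fin D0; case: (wsum _ xi) => [d| |] // _ d0; rewrite lee_fin in d0.
rewrite -EFinM nneseriesZl; last by move=> j _; rewrite lee_fin invr_ge0 sqr_ge0.
apply: (@le_trans _ _ ((d * c)%:E * (pi ^+ 2 / 6 : R)%:E)%E).
  by apply: lee_wpmul2l; [rewrite lee_fin mulr_ge0|exact: nneseries_sqrV_le].
by rewrite -!EFinM lee_fin le_eqVlt; apply/orP; left; apply/eqP; ring.
Qed.

(** For a truncated [eta] the adjoint relation is linearity of x, applied to one basis vector at a
    time. *)
Lemma adjfun_trunc x xi eta N : is_op x -> in_s' xi -> in_s' eta ->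
  \sum_(i < N) adjfun x xi i * conjc (eta i) = pairing xi (x (trunc N eta)).
Proof.
move=> ox sxi seta; elim: N => [|N IH].
  rewrite big_ord0; apply/esym/pairing_eq.
  (* That x maps 0 to 0 is homogeneity with the scalar 0. *)
  rewrite (_ : trunc 0 eta = fun j => 0 * eta j); last by apply/funext => j; rewrite mul0r.
  have [_ [h _]] := ox; rewrite h //.
  by apply: (@ccvg_near_cst _ _ _ 0) => M _; rewrite big1 // => j _; rewrite mul0r conjc0 mulr0.
have [hD [hZ _]] := ox.
rewrite big_ord_recr /= IH truncS hD; [|exact: in_s'_trunc|exact/in_s'Z/in_s'_delta].
rewrite hZ; last exact: in_s'_delta.
rewrite pairingDZr //; first by rewrite mulrC.
  by move=> n; apply: op_in_s => //; exact: in_s'_trunc.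
by move=> n; apply: op_in_s => //; exact: in_s'_delta.
Qed.

(** The error of the N-th partial sum is <xi, x (tail N eta)>. If xi lies in step k and eta in step
    l, continuity of x from step l into the k-norm bounds it by a constant times the dual l-norm of
    the tail, which tends to 0. *)
Lemma adjfun_pairing x xi eta : is_op x -> in_s' xi -> in_s' eta ->
  pairing (adjfun x xi) eta = pairing xi (x eta).
Proof.
move=> ox sxi seta; apply: pairing_eq; apply: ccvg_dist0.
have [hD [hZ _]] := ox.
have diff N : cabs (\sum_(i < N) adjfun x xi i * conjc (eta i) - pairing xi (x eta)) =
    cabs (pairing xi (x (tail N eta))).
  rewrite adjfun_trunc // -{2}(trunc_tail N eta) hD; [|exact: in_s'_trunc|exact: in_s'_tail].
  rewrite (_ : (fun j => _) = fun j => x (trunc N eta) j + 1 * x (tail N eta) j); last first.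
    by apply/funext => j; rewrite mul1r.
  rewrite pairingDZr //; last 2 first.
  - by move=> n; apply: op_in_s => //; exact: in_s'_trunc.
  - by move=> n; apply: op_in_s => //; exact: in_s'_tail.
  rewrite conjc1 mul1r opprD addrA subrr add0r -mulN1r cabsM.
  by rewrite /cabs /= sqrrN expr1n oppr0 expr0n addr0 sqrtr1 mul1r.
under eq_fun do rewrite diff.
move/in_s'P: (sxi) => [k fk]; move/in_s'P: (seta) => [l fl].
have [c c0 hc] := op_bound ox l k.
have D0 := wsum_ge0 xi (@wtV_gt0 R k).
have [d d0 dE] : exists2 d, 0 <= d & wsum (wtV R k) xi = d%:E.
  by move: fk D0; case: (wsum _ xi) => [d| |] // _ d0; exists d.
have tE N : wsum (wtV R l) (tail N eta) \is a fin_num.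
  rewrite ge0_fin_numE ?wsum_ge0 //; last exact: wtV_gt0.
  by apply: le_lt_trans fl; apply: wsum_tail_le; exact: wtV_gt0.
pose t N := fine (wsum (wtV R l) (tail N eta)).
have t0 : t @ \oo --> 0.
  by apply: (fine_cvg (wsum_tail_cvg0 (@wtV_gt0 R l) fl)).
have ub N : cabs (pairing xi (x (tail N eta))) <= Num.sqrt (d * c * t N).
  rewrite -[leLHS]ger0_norm ?cabs_ge0 // -sqrtr_sqr.
  have [||_] := @pairing_dual_s k xi (x (tail N eta)) => //.
    by apply: op_in_s => //; exact: in_s'_tail.
  rewrite dE => h.
  have t1 : 0 <= t N by apply: fine_ge0; apply: wsum_ge0; exact: wtV_gt0.
  rewrite (@ler_sqrt _ _ (d * c * t N)) ?mulr_ge0 // -lee_fin.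
  apply: (le_trans h); rewrite -mulrA EFinM; apply: lee_wpmul2l => //.
  by rewrite EFinM fineK //; apply: hc; rewrite ltey_eq tE.
have st : (fun N => Num.sqrt (d * c * t N)) @ \oo --> 0.
  have cv : (fun N => d * c * t N) @ \oo --> d * c * 0 by exact: cvgMr.
  have := cvg_comp _ _ cv (@sqrt_continuous R (d * c * 0)).
  by rewrite mulr0 sqrtr0.
apply: (squeeze_cvgr _ (cvg_cst 0) st).
by apply: nearW => N; rewrite cabs_ge0 ub.
Qed.

(** [epsilon] satisfies its predicate once a witness exists, and [adjfun x] is that witness. *)
Lemma adj_spec x : is_op x -> is_op (adj x) /\
  forall xi eta, in_s' xi -> in_s' eta -> pairing (adj x xi) eta = pairing xi (x eta).
Proof.
move=> ox; pose P (y : op R) := is_op y /\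
  forall xi eta, in_s' xi -> in_s' eta -> pairing (y xi) eta = pairing xi (x eta).
have exP : exists y, P y.
  exists (adjfun x).
  by split; [exact: adjfun_is_op|move=> xi eta h h'; exact: adjfun_pairing].
exact: (epsilon_spec (inhabits (fun _ _ => 0)) P exP).
Qed.

End Operators.

(** * Row and column sums *)

Section OperatorNorms.
Variable R : realType.
Local Notation C := R[i].
Implicit Types (xi eta zeta : cseq R) (w : nat -> R) (x y : op R).

Definition colsq x k : R := fine (wsum (fun=> 1) (x (delta 1 k))).
(** Row k of x is, up to conjugation, column k of its adjoint (see [adj_entry]). *)
Definition rowsq x k : R := colsq (adj x) k.

Lemma sqrte_le1 (e : \bar R) : (sqrte e <= 1)%E = (e <= 1)%E.
Proof.
have {1}-> : (1 = sqrte 1 :> \bar R)%E by rewrite /= sqrtr1.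
by rewrite lee_sqrt.
Qed.

Lemma wt0 : wt R 0 = fun=> 1.
Proof. by apply/funext => j; rewrite /wt muln0 expr0. Qed.

Lemma colsq_fin x k : is_op x -> wsum (fun=> 1) (x (delta 1 k)) = (colsq x k)%:E.
Proof.
move=> ox; rewrite /colsq fineK // ge0_fin_numE; last exact: wsum_ge0.
by rewrite -wt0; apply: op_in_s => //; exact: in_s'_delta.
Qed.

Lemma colsq_ge0 x k : 0 <= colsq x k.
Proof. by apply: fine_ge0; exact: wsum_ge0. Qed.

Lemma wt_rowcol_ge0 n x k : 0 <= wt R n k * ((colsq x k + rowsq x k) / 2).
Proof.
apply: mulr_ge0; first exact/ltW/wt_gt0.
by rewrite divr_ge0 // addr_ge0 ?colsq_ge0.
Qed.

Lemma pairing_col x k : is_op x ->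
  pairing (x (delta 1 k)) (x (delta 1 k)) = ((colsq x k)%:C)%C.
Proof. by move=> ox; rewrite pairing_self // colsq_fin. Qed.

Lemma adj_is_op x : is_op x -> is_op (adj x).
Proof. by move=> /adj_spec[]. Qed.

Lemma adj_pairing x xi eta : is_op x -> in_s' xi -> in_s' eta ->
  pairing (adj x xi) eta = pairing xi (x eta).
Proof. by move=> /adj_spec[_]; apply. Qed.

Lemma adj_entry x k l : is_op x -> adj x (delta 1 k) l = conjc (x (delta 1 l) k).
Proof.
move=> ox; rewrite -[LHS]pairing_deltar adj_pairing ?pairing_deltal //; exact: in_s'_delta.
Qed.

(** The entry is <x^* x e_k, e_k> = |x e_k|^2. The scalar [c] is carried along because the test
    vectors of [opnorm_diag_ge] are multiples of e_k. *)
Lemma adjmul_diag x c k : is_op x ->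
  opmul (adj x) x (delta c k) k = c * ((colsq x k)%:C)%C.
Proof.
move=> ox; rewrite /opmul -[LHS]pairing_deltar.
have sd b : in_s' (delta b k : cseq R) by exact: in_s'_delta.
rewrite adj_pairing //; last exact: op_in_s'.
rewrite op_delta // pairingZl ?pairing_col //; first exact: op_in_s'.
by move=> n; exact: op_in_s.
Qed.

Lemma muladj_diag x c k : is_op x ->
  opmul x (adj x) (delta c k) k = c * ((rowsq x k)%:C)%C.
Proof.
move=> ox; rewrite /opmul.
have oa := adj_is_op ox.
have sd b : in_s' (delta b k : cseq R) by exact: in_s'_delta.
(* [adj_pairing] moves x out of the second argument, so the entry is first turned into a conjugated
   pairing with e_k on the left. *)
rewrite -[LHS]conjcK -pairing_deltal -adj_pairing //; last exact: op_in_s'.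
rewrite (op_delta c k oa).
(* With a zero first summand, [pairingDZr] becomes conjugate homogeneity in the second argument. *)
pose z : cseq R := fun=> 0.
have -> : (fun j => c * adj x (delta 1 k) j) = (fun j => z j + c * adj x (delta 1 k) j).
  by apply/funext => j; rewrite add0r.
rewrite pairingDZr //.
- have cE (p q : C) : conjc (p + conjc c * q) = conjc p + c * conjc q.
    by rewrite rmorphD rmorphM /= conjcK.
  rewrite pairing_col // cE conjc_real.
  have -> : pairing (adj x (delta 1 k)) z = 0.
    apply: pairing_eq; apply: (@ccvg_near_cst _ _ _ 0) => N _.
    by rewrite big1 // => j _; rewrite conjc0 mulr0.
  by rewrite conjc0 add0r.
- exact: op_in_s'.
- by move=> n; rewrite /wsum eseries0 ?ltry // => j _ _; rewrite cabs0 expr0n mul0r.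
- by move=> n; exact: op_in_s.
Qed.

(** * Operator norms against diagonal entries, rows and columns *)

Lemma opnorm_ge0 n x : (0 <= opnorm n x)%E.
Proof.
apply: (@le_trans _ _ (snorm n (x (fun=> 0)))); first by rewrite snormE sqrte_ge0.
apply: ereal_sup_ubound; exists (fun=> 0) => //=.
rewrite dnormE /wsum eseries0 ?sqrte0 // => j _ _.
by rewrite cabs0 expr0n mul0r.
Qed.

(** With a = (k+1)^n, the vector a e_k has dual norm 1, and entry k of its image alone contributes
    (a t) a to the norm of the image. *)
Lemma opnorm_diag_ge n x k (t : R) : 0 <= t ->
  (forall c, x (delta c k) k = c * (t%:C)%C) -> ((t * wt R n k)%:E <= opnorm n x)%E.
Proof.
move=> t0 ht; pose a : R := k.+1%:R ^+ n.
have a0 : 0 < a by rewrite exprn_gt0.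
have wa : wt R n k = a ^+ 2 by rewrite /wt mulnC exprM.
apply: (@le_trans _ _ (snorm n (x (delta (a%:C)%C k)))); last first.
  apply: ereal_sup_ubound; exists (delta (a%:C)%C k) => //=.
  rewrite dnormE wsum_delta; last exact: wtV_gt0.
  rewrite cabs_real real_normK ?num_real // /wtV wa divff ?sqrtr1 ?lexx //= ?sqrtr1 //.
  by rewrite gt_eqF // exprn_gt0.
rewrite snormE; apply: le_trans (_ : _ <= sqrte ((a * t) ^+ 2 * wt R n k)%:E)%E _.
  rewrite wa -exprMn /= sqrtr_sqr ger0_norm; last by rewrite !mulr_ge0 // ltW.
  by rewrite lee_fin le_eqVlt; apply/orP; left; apply/eqP; ring.
rewrite lee_sqrt ?wsum_ge0 //; last exact: wt_gt0.
apply: le_trans (wsum_term_le _ k (@wt_gt0 R n)).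
by rewrite ht cabsM !cabs_real !ger0_norm // ltW.
Qed.

(** Through the adjoint, entry k of x xi is up to conjugation the pairing of x^* e_k with xi, that
    is, row k of x against xi. Cauchy-Schwarz with the weights [wt n] and [wtV n] then uses that xi
    has dual norm at most 1. *)
Lemma snorm_le_entries n x xi : is_op x -> (dnorm n xi <= 1)%E ->
  (wsum (wt R n) (x xi) <=
    \sum_(k <oo) \sum_(l <oo) (cabs (x (delta 1%R l) k) ^+ 2 * (wt R n k * wt R n l))%:E)%E.
Proof.
move=> ox; rewrite dnormE sqrte_le1 => xi1.
have oa := adj_is_op ox.
have sxi : in_s' xi by apply/in_s'P; exists n; apply: le_lt_trans xi1 (ltry _).
apply: lee_nneseries => k _; first by move=> _; apply: wterm_ge0; exact: wt_gt0.
have e1 : wsum (wt R n) (adj x (delta 1 k)) =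
    (\sum_(l <oo) (cabs (x (delta 1%R l) k) ^+ 2 * wt R n l)%:E)%E.
  by apply: eq_eseriesr => l _; rewrite adj_entry // cabsJ.
under eq_eseriesr do rewrite mulrCA EFinM.
rewrite nneseriesZl; last by move=> l _; rewrite lee_fin mulr_ge0 ?sqr_ge0 ?ltW ?wt_gt0.
rewrite -e1 mulrC EFinM; apply: lee_wpmul2l; first by rewrite lee_fin ltW ?wt_gt0.
have sd : in_s' (delta 1 k : cseq R) by exact: in_s'_delta.
rewrite -(cabsJ (x xi k)) -pairing_deltal -adj_pairing //.
have [||_ h] := @pairing_fin R (wt R n) (adj x (delta 1 k)) xi (@wt_gt0 R n).
- exact: op_in_s.
- exact: le_lt_trans xi1 (ltry _).
apply: (le_trans h).
rewrite -[leRHS]mule1; apply: lee_wpmul2l => //; apply: wsum_ge0; exact: wt_gt0.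
Qed.

(** After a b <= (a^2 + b^2) / 2 each weight depends on one index. The part weighted in [k] sums
    over [l] to row sums; the part weighted in [l] reaches the column sums by interchanging two
    non-negative series. *)
Lemma entries_le_rowcol n x : is_op x ->
  (\sum_(k <oo) \sum_(l <oo) (cabs (x (delta 1%R l) k) ^+ 2 * (wt R n k * wt R n l))%:E
  <= \sum_(k <oo) (wt R (2 * n) k * ((colsq x k + rowsq x k) / 2))%:E)%E.
Proof.
move=> ox; have oa := adj_is_op ox.
have w2 k : wt R (2 * n) k = wt R n k ^+ 2 by rewrite /wt -exprM; congr (_ ^+ _); lia.
pose e k l : \bar R := (cabs (x (delta 1 l) k) ^+ 2 / 2)%:E.
have e0 k l : (0 <= e k l)%E by rewrite lee_fin divr_ge0 ?sqr_ge0.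
have we0 (a : R) k l : 0 <= a -> (0 <= a%:E * e k l)%E by move=> ?; rewrite mule_ge0.
have q0 k l : 0 <= cabs (x (delta 1 l) k) ^+ 2 * (wt R n k * wt R n l).
  by apply: mulr_ge0; [exact: sqr_ge0|rewrite mulr_ge0 // ltW ?wt_gt0].
have wt0' k : 0 <= wt R (2 * n) k by rewrite ltW ?wt_gt0.
have colE l : (\sum_(k <oo) e k l = (colsq x l / 2)%:E)%E.
  rewrite EFinM -colsq_fin // muleC /wsum -nneseriesZl; last by move=> k _;
    exact: (@wterm_ge0 _ (fun=> 1)).
  by apply: eq_eseriesr => k _; rewrite mulr1 /e mulrC EFinM.
have rowE k : (\sum_(l <oo) e k l = (rowsq x k / 2)%:E)%E.
  rewrite EFinM -colsq_fin // muleC /wsum -nneseriesZl; last by move=> l _;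
    exact: (@wterm_ge0 _ (fun=> 1)).
  by apply: eq_eseriesr => l _; rewrite mulr1 /e mulrC EFinM adj_entry // cabsJ.
apply: (@le_trans _ _ (\sum_(k <oo) \sum_(l <oo)
    ((wt R (2 * n) k)%:E * e k l + (wt R (2 * n) l)%:E * e k l))%E).
  apply: lee_nneseries => k _.
    by move=> _; apply: nneseries_ge0 => l _ _; rewrite lee_fin.
  apply: lee_nneseries => l _; first by move=> _; rewrite lee_fin.
  rewrite /e -!EFinM -EFinD lee_fin !w2.
  have := sqr_ge0 (cabs (x (delta 1 l) k)); have := sqr_ge0 (wt R n k - wt R n l).
  move: (cabs (x (delta 1 l) k) ^+ 2) => c h c0.
  have := mulr_ge0 c0 h; lra.
have rc0 y k : (0 <= (wt R (2 * n) k * (colsq y k / 2))%:E)%E.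
  by rewrite lee_fin mulr_ge0 // divr_ge0 // colsq_ge0.
have rowS : (\sum_(k <oo) \sum_(l <oo) (wt R (2 * n) k)%:E * e k l =
    \sum_(k <oo) (wt R (2 * n) k * (rowsq x k / 2))%:E)%E.
  by apply: eq_eseriesr => k _; rewrite nneseriesZl // rowE EFinM.
have colS : (\sum_(k <oo) \sum_(l <oo) (wt R (2 * n) l)%:E * e k l =
    \sum_(k <oo) (wt R (2 * n) k * (colsq x k / 2))%:E)%E.
  rewrite nneseries_interchange; last by move=> *; exact: we0.
  by apply: eq_eseriesr => k _; rewrite nneseriesZl // colE EFinM.
have -> : (\sum_(k <oo) \sum_(l <oo) ((wt R (2 * n) k)%:E * e k l + (wt R (2 * n) l)%:E * e k l) =
    \sum_(k <oo) \sum_(l <oo) (wt R (2 * n) k)%:E * e k l +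
    \sum_(k <oo) \sum_(l <oo) (wt R (2 * n) l)%:E * e k l)%E.
  rewrite -nneseriesD; first last.
  - by move=> k _ _; apply: nneseries_ge0 => l _ _; exact: we0.
  - by move=> k _ _; apply: nneseries_ge0 => l _ _; exact: we0.
  by apply: eq_eseriesr => k _; rewrite nneseriesD // => l _ _; exact: we0.
rewrite rowS colS -nneseriesD; [|by move=> *; exact: rc0|by move=> *; exact: rc0].
rewrite le_eqVlt; apply/orP; left; apply/eqP; apply: eq_eseriesr => k _.
by rewrite -EFinD; congr (_%:E); ring.
Qed.

Lemma opnorm_le_rowcol n x : is_op x ->
  (opnorm n x ^+ 2 <= \sum_(k <oo) (wt R (2 * n) k * ((colsq x k + rowsq x k) / 2))%:E)%E.
Proof.
move=> ox; set S := (\sum_(k <oo) _)%E.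
have S0 : (0 <= S)%E.
  by apply: nneseries_ge0 => k _ _; rewrite lee_fin wt_rowcol_ge0.
rewrite -(sqr_sqrte S0) lee_sqr ?opnorm_ge0 ?sqrte_ge0 //.
apply: ge_ereal_sup => _ [xi /= h <-].
rewrite snormE lee_sqrt //; apply: le_trans (snorm_le_entries ox h) _.
exact: entries_le_rowcol.
Qed.

Lemma opnorm_fin n x : is_op x -> opnorm n x \is a fin_num.
Proof.
move=> ox; rewrite ge0_fin_numE ?opnorm_ge0 //.
have [c c0 hc] := op_bound ox n n.
apply: (@le_lt_trans _ _ (sqrte c%:E)); last by rewrite /= ltry.
apply: ge_ereal_sup => _ [xi h <-].
have {}h : (wsum (wtV R n) xi <= 1)%E by move: h; rewrite /= dnormE sqrte_le1.
rewrite snormE lee_sqrt //; apply: (le_trans (hc _ (le_lt_trans h (ltry _)))).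
by rewrite -[leRHS]mule1; apply: lee_wpmul2l.
Qed.

(** [M] is left abstract so that both the squared rc-norm and the norm of the sum of |x_j|^2 can be
    inserted. It may be infinite. *)
Lemma sum_opnorm_sqr_le n m (xs : nat -> op R) (M : \bar R) : all_op m xs ->
  (forall k, ((\sum_(i < m) (colsq (xs i) k + rowsq (xs i) k) / 2) * wt R (2 * n + 1) k)%:E <=
    M)%E ->
  (\sum_(i < m) opnorm n (xs i) ^+ 2 <= (pi ^+ 2 / 6)%:E * M)%E.
Proof.
move=> ax hM.
have s0 k : 0 <= \sum_(i < m) (colsq (xs i) k + rowsq (xs i) k) / 2.
  by apply: sumr_ge0 => i _; rewrite divr_ge0 ?addr_ge0 ?colsq_ge0.
have M0 : (0 <= M)%E by apply: le_trans (hM 0%N); rewrite lee_fin mulr_ge0 // ltW ?wt_gt0.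
have p0 : 0 < pi ^+ 2 / 6 :> R by rewrite divr_gt0 ?exprn_gt0 ?pi_gt0.
move/gee0P : M0 hM => [->|[M' M0 ->]] hM; first by rewrite gt0_muley ?leey ?lte_fin.
apply: (@le_trans _ _ (\sum_(i < m) \sum_(k <oo) (wt R (2 * n) k * ((colsq (xs i) k + rowsq (xs
  i) k) / 2))%:E)%E).
  by apply: lee_sum => i _; apply: opnorm_le_rowcol; exact: ax.
rewrite -nneseries_sum; last first.
  by move=> i k _; rewrite lee_fin wt_rowcol_ge0.
apply: (@le_trans _ _ (\sum_(k <oo) (M'%:E * ((k.+1%:R ^+ 2)^-1 : R)%:E))%E).
  apply: lee_nneseries => k _.
    by move=> _; apply: sume_ge0 => i _; rewrite lee_fin wt_rowcol_ge0.
  rewrite sumEFin -mulr_sumr -EFinM lee_fin.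
  have := hM k; rewrite lee_fin => h.
  rewrite ler_pdivlMr ?exprn_gt0 //; apply: le_trans h.
  rewrite (_ : wt R (2 * n + 1) k = wt R (2 * n) k * k.+1%:R ^+ 2); last first.
    by rewrite /wt -exprD; congr (_ ^+ _); lia.
  by rewrite le_eqVlt; apply/orP; left; apply/eqP; ring.
rewrite nneseriesZl; last by move=> k _; rewrite lee_fin invr_ge0 sqr_ge0.
by rewrite muleC; apply: lee_wpmul2r => //; exact: nneseries_sqrV_le.
Qed.

Lemma opsum_diag_ge n m (f : nat -> op R) (t : nat -> R) k :
  (forall i, 0 <= t i) ->
  (forall i c, (i < m)%N -> f i (delta c k) k = c * ((t i)%:C)%C) ->
  (((\sum_(i < m) t i) * wt R n k)%:E <= opnorm n (opsum m f))%E.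
Proof.
move=> t0 h; apply: opnorm_diag_ge; first exact: sumr_ge0.
move=> c; rewrite /opsum rmorph_sum mulr_sumr; apply: eq_bigr => i _.
exact: h.
Qed.

(** The mean of the two diagonal sums is at most the larger one, and the maximum in [rcnorm]
    dominates both. *)
Lemma sum_opnorm_sqr_rc n m (xs : nat -> op R) : all_op m xs ->
  (\sum_(i < m) opnorm n (xs i) ^+ 2 <= (pi ^+ 2 / 6)%:E * rcnorm (2 * n + 1) m xs ^+ 2)%E.
Proof.
move=> ax; apply: sum_opnorm_sqr_le => // k.
rewrite /rcnorm !esqrtE; set A := opnorm _ _; set B := opnorm _ _.
have hA : (((\sum_(i < m) colsq (xs i) k) * wt R (2 * n + 1) k)%:E <= A)%E.
  by apply: (@opsum_diag_ge _ _ _ (fun i => colsq (xs i) k)) => [i|i c im];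
    [exact: colsq_ge0|rewrite adjmul_diag //; exact: ax].
have hB : (((\sum_(i < m) rowsq (xs i) k) * wt R (2 * n + 1) k)%:E <= B)%E.
  by apply: (@opsum_diag_ge _ _ _ (fun i => rowsq (xs i) k)) => [i|i c im];
    [exact: colsq_ge0|rewrite muladj_diag //; exact: ax].
have max2 : (maxe (sqrte A) (sqrte B) ^+ 2 = maxe A B)%E.
  have A0 : (0 <= A)%E by exact: opnorm_ge0.
  have B0 : (0 <= B)%E by exact: opnorm_ge0.
  have [AB|BA] := leP A B.
    by rewrite max_r ?sqr_sqrte // lee_sqrt.
  by rewrite max_l ?sqr_sqrte // lee_sqrt // ltW.
rewrite max2 -mulr_suml big_split /=.
move: hA hB; move: (\sum_(i < m) colsq (xs i) k) (\sum_(i < m) rowsq (xs i) k) (wt R _ k) => a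
  b c hA hB.
have [h|h] := leP (a * c) (b * c).
  apply: (@le_trans _ _ (b * c)%:E); first by rewrite lee_fin; lra.
  by rewrite le_max hB orbT.
apply: (@le_trans _ _ (a * c)%:E); first by rewrite lee_fin; lra.
by rewrite le_max hA.
Qed.

(** The factor 1/2 in |x|^2 makes its diagonal entries equal to the means of row and column sums. *)
Lemma sum_opnorm_sqr_absq n m (xs : nat -> op R) : all_op m xs ->
  (\sum_(i < m) opnorm n (xs i) ^+ 2 <=
   (pi ^+ 2 / 6)%:E * opnorm (2 * n + 1) (opsum m (fun i => absq (xs i))))%E.
Proof.
move=> ax; apply: sum_opnorm_sqr_le => // k.
apply: (@opsum_diag_ge _ _ _ (fun i => (colsq (xs i) k + rowsq (xs i) k) / 2)) => [i|i c im];
  first by rewrite divr_ge0 ?addr_ge0 ?colsq_ge0.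
rewrite /absq /opscale /opadd adjmul_diag ?muladj_diag; try exact: ax.
rewrite rmorphM rmorphD fmorphV rmorph_nat /=; ring.
Qed.

End OperatorNorms.

(** * Bilinear and linear forms *)

Section Bounds.
Variable R : realType.
Local Notation C := R[i].
Implicit Types (xi eta zeta : cseq R) (x y : op R).

Lemma opscale_is_op c x : is_op x -> is_op (opscale c x).
Proof.
move=> ox; have [hD [hZ _]] := ox; apply: op_boundP.
- by move=> xi eta h h'; rewrite /opscale hD //; apply/funext => j; rewrite mulrDr.
- by move=> b xi h; rewrite /opscale hZ //; apply/funext => j; rewrite mulrCA.
move=> k n; have [d d0 hd] := op_bound ox k n.
exists (cabs c ^+ 2 * d); first by rewrite mulr_ge0 ?sqr_ge0.
move=> xi h; rewrite wsumZ; last exact: wt_gt0.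
by rewrite (EFinM (cabs c ^+ 2) d) -muleA; apply: lee_wpmul2l; [rewrite lee_fin sqr_ge0|exact: hd].
Qed.

Lemma opnorm_scale_le n c x : (opnorm n (opscale c x) <= (cabs c)%:E * opnorm n x)%E.
Proof.
apply: ge_ereal_sup => _ [xi /= h <-].
rewrite snormE wsumZ; last exact: wt_gt0.
rewrite sqrteM ?lee_fin ?sqr_ge0 //= sqrtr_sqr ger0_norm ?cabs_ge0 //.
apply: lee_wpmul2l; first by rewrite lee_fin cabs_ge0.
by rewrite -snormE; apply: ereal_sup_ubound; exists xi.
Qed.

(** Testing on scaled basis vectors, one vanishing norm kills every matrix entry, and the
    Hilbert-Schmidt bound then kills all other norms. This links the norm in which a form is known
    to be continuous with the index [n] of the estimate. *)
Lemma opnorm_eq0 n n' x : is_op x -> opnorm n x = 0%E -> opnorm n' x = 0%E.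
Proof.
move=> ox h.
have entry0 k l : cabs (x (delta 1 l) k) = 0.
  pose a : R := l.+1%:R ^+ n.
  have a0 : 0 < a by rewrite exprn_gt0.
  have : (snorm n (x (delta (a%:C)%C l)) <= 0)%E.
    rewrite -h; apply: ereal_sup_ubound; exists (delta (a%:C)%C l) => //=.
    rewrite dnormE sqrte_le1 wsum_delta; last exact: wtV_gt0.
    rewrite cabs_real real_normK ?num_real // /wtV /wt mulnC exprM divff //.
    by rewrite gt_eqF // exprn_gt0.
  rewrite snormE -[X in (_ <= X)%E]sqrte0 lee_sqrt // => h0.
  have := le_trans (wsum_term_le _ k (@wt_gt0 R n)) h0.
  rewrite lee_fin (op_delta _ _ ox) cabsM cabs_real exprMn => h1.
  apply/eqP; rewrite -sqrf_eq0 eq_le sqr_ge0 andbT.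
  move: h1; rewrite pmulr_lle0 ?wt_gt0 // pmulr_rle0 // exprn_gt0 // normr_gt0 gt_eqF //.
apply/eqP; rewrite eq_le opnorm_ge0 andbT.
apply: ge_ereal_sup => _ [xi /= hxi <-].
rewrite snormE -[X in (_ <= X)%E]sqrte0 lee_sqrt //.
apply: (le_trans (snorm_le_entries ox hxi)).
rewrite eseries0 // => k _ _; rewrite eseries0 // => l _ _.
by rewrite entry0 expr0n mul0r.
Qed.

Lemma opnorm_normalize n x : is_op x -> (0 < opnorm n x)%E ->
  exists r (x' : op R), [/\ opnorm n x = r%:E, is_op x', (opnorm n x' <= 1)%E, 0 < r
    & x = opscale ((r%:C)%C) x'].
Proof.
move=> ox; have /fineK := opnorm_fin n ox.
move: (fine _) => r rE; rewrite -rE lte_fin => r0.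
exists r, (opscale (((r^-1)%:C)%C) x); split => //; first exact: opscale_is_op.
- apply: (le_trans (opnorm_scale_le _ _ _)).
  by rewrite -rE cabs_real ger0_norm ?invr_ge0 ?(ltW r0) // -EFinM mulVf ?gt_eqF.
- apply/funext => xi; apply/funext => j; rewrite /opscale mulrA -rmorphM /= divff ?mul1r //.
  by rewrite gt_eqF.
Qed.

(* [bnorm n u] may be +oo, and [0 * +oo = 0]: the cases of a vanishing norm need
   [opnorm_eq0] together with the continuity of [u] in some other norm. *)
Lemma bilin_bound (u : op R -> op R -> C) n x y : is_bilin u -> cont_bilin u ->
  is_op x -> is_op y ->
  ((cabs (u x y))%:E <= bnorm n u * (opnorm n x * opnorm n y))%E.
Proof.
move=> bu [N [c cu]] ox oy.
have := opnorm_ge0 n x; rewrite le_eqVlt => /predU1P[/esym x0|x0].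
  apply: (le_trans (cu _ _ ox oy)).
  by rewrite (opnorm_eq0 N ox x0) x0 mule0 !mul0e mule0.
have := opnorm_ge0 n y; rewrite le_eqVlt => /predU1P[/esym y0|y0].
  apply: (le_trans (cu _ _ ox oy)).
  by rewrite (opnorm_eq0 N oy y0) y0 !mule0.
have [r [x' [-> ox' x'1 r0 ->]]] := opnorm_normalize ox x0.
have [s [y' [-> oy' y'1 s0 ->]]] := opnorm_normalize oy y0.
have os := opscale_is_op ((s%:C)%C) oy'.
have [_ -> _ _] := bu ((r%:C)%C) _ _ _ _ ox' ox' os os.
have [_ _ _ ->] := bu ((s%:C)%C) _ _ _ _ ox' ox' oy' oy'.
rewrite !cabsM !cabs_real !ger0_norm ?(ltW r0) ?(ltW s0) // mulrA mulrC EFinM -(EFinM r s).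
apply: lee_wpmul2r; first by rewrite lee_fin mulr_ge0 ?ltW.
by apply: ereal_sup_ubound; exists x', y'.
Qed.

Lemma lin_bound (phi : op R -> C) n x : is_lin phi -> cont_fun phi -> is_op x ->
  ((cabs (phi x))%:E <= fnorm n phi * opnorm n x)%E.
Proof.
move=> lp [N [c cp]] ox.
have := opnorm_ge0 n x; rewrite le_eqVlt => /predU1P[/esym x0|x0].
  by apply: (le_trans (cp _ ox)); rewrite (opnorm_eq0 N ox x0) x0 !mule0.
have [r [x' [-> ox' x'1 r0 ->]]] := opnorm_normalize ox x0.
have [_ ->] := lp ((r%:C)%C) _ _ ox' ox'.
rewrite cabsM cabs_real ger0_norm ?(ltW r0) // mulrC EFinM.
apply: lee_wpmul2r; first by rewrite lee_fin ltW.
by apply: ereal_sup_ubound; exists x'.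
Qed.

Lemma zero_is_op : is_op (fun _ _ => 0 : C).
Proof.
apply: op_boundP.
- by move=> xi eta _ _; apply/funext => j; rewrite addr0.
- by move=> c xi _; apply/funext => j; rewrite mulr0.
move=> k n; exists 0 => // xi _; rewrite mul0e /wsum eseries0 // => j _ _.
by rewrite cabs0 expr0n mul0r.
Qed.

Lemma opnorm_zero n : opnorm n (fun _ _ => 0 : C) = 0%E.
Proof.
apply/eqP; rewrite eq_le opnorm_ge0 andbT; apply: ge_ereal_sup => _ [xi _ <-].
rewrite snormE /wsum eseries0 ?sqrte0 // => j _ _.
by rewrite cabs0 expr0n mul0r.
Qed.

Lemma bnorm_ge0 n (u : op R -> op R -> C) : (0 <= bnorm n u)%E.
Proof.
pose z : op R := fun _ _ => 0.
apply: (@le_trans _ _ (cabs (u z z))%:E); first by rewrite lee_fin cabs_ge0.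
apply: ereal_sup_ubound; exists z, z.
by split=> //; rewrite ?opnorm_zero //; exact: zero_is_op.
Qed.

Lemma rcnorm_ge0 n m (xs : nat -> op R) : (0 <= rcnorm n m xs)%E.
Proof. by rewrite /rcnorm !esqrtE le_max sqrte_ge0. Qed.

(** The single norms are finite, so Cauchy-Schwarz runs in [R], while [A] and [B] may be infinite
    and their roots stay in [\bar R]. Each root takes a factor sqrt K, hence K in the product. *)
Lemma sum_opnormM_le n m (xs ys : nat -> op R) (K : R) (A B : \bar R) :
  all_op m xs -> all_op m ys -> 0 <= K -> (0 <= A)%E -> (0 <= B)%E ->
  (\sum_(i < m) opnorm n (xs i) ^+ 2 <= K%:E * A)%E ->
  (\sum_(i < m) opnorm n (ys i) ^+ 2 <= K%:E * B)%E ->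
  (\sum_(i < m) opnorm n (xs i) * opnorm n (ys i) <= K%:E * (sqrte A * sqrte B))%E.
Proof.
move=> ax ay K0 A0 B0 hA hB.
have K0E : (0 <= K%:E)%E by rewrite lee_fin.
have -> : (K%:E * (sqrte A * sqrte B) = sqrte (K%:E * A) * sqrte (K%:E * B))%E.
  by rewrite !(sqrteM _ K0E) muleACA -expe2 sqr_sqrte.
have A1 : (0 <= K%:E * A)%E by exact: mule_ge0.
have B1 : (0 <= K%:E * B)%E by exact: mule_ge0.
move: (K%:E * A)%E (K%:E * B)%E A1 B1 hA hB => {A0 B0} {}A {}B A0 B0.
pose X i := fine (opnorm n (xs i)); pose Y i := fine (opnorm n (ys i)).
have XE (i : 'I_m) : opnorm n (xs i) = (X i)%:E by rewrite fineK ?opnorm_fin //; exact: ax.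
have YE (i : 'I_m) : opnorm n (ys i) = (Y i)%:E by rewrite fineK ?opnorm_fin //; exact: ay.
have -> : (\sum_(i < m) opnorm n (xs i) ^+ 2 = (\sum_(i < m) X i ^+ 2)%:E)%E.
  by rewrite -sumEFin; apply: eq_bigr => i _; rewrite XE EFin_expe.
have -> : (\sum_(i < m) opnorm n (ys i) ^+ 2 = (\sum_(i < m) Y i ^+ 2)%:E)%E.
  by rewrite -sumEFin; apply: eq_bigr => i _; rewrite YE EFin_expe.
have -> : (\sum_(i < m) opnorm n (xs i) * opnorm n (ys i) = (\sum_(i < m) X i * Y i)%:E)%E.
  by rewrite -sumEFin; apply: eq_bigr => i _; rewrite XE YE.
move=> hA hB; rewrite -sqrteM //.
apply: (@le_trans _ _ (sqrte ((\sum_(i < m) X i * Y i) ^+ 2)%:E)).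
  by rewrite /= sqrtr_sqr lee_fin ler_norm.
rewrite lee_sqrt; last exact: mule_ge0.
apply: (@le_trans _ _ ((\sum_(i < m) X i ^+ 2) * (\sum_(i < m) Y i ^+ 2))%:E).
  by rewrite lee_fin sum_cauchy_schwarz.
by rewrite EFinM; apply: lee_pmul => //; rewrite lee_fin; apply: sumr_ge0 => *; rewrite sqr_ge0.
Qed.

End Bounds.

Theorem theorem2p3 (R : realType) :
  exists K : R, K <= pi ^+ 2 / 6%:R /\
  (* (a) *)
  (forall (n m : nat) (xs ys : nat -> op R), (0 < n)%N ->
     all_op m xs -> all_op m ys ->
     (pinorm n m xs ys <= (2%:R * K)%:E * ahnorm (2 * n + 1) m xs ys)%E) /\
  (* (b) *)
  (forall u : op R -> op R -> R[i], is_bilin u -> cont_bilin u ->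
   forall (n m : nat) (xs ys : nat -> op R), (0 < n)%N -> (0 < m)%N ->
     all_op m xs -> all_op m ys ->
     ((cabs (\sum_(j < m) u (xs j) (ys j)))%:E <=
        K%:E * bnorm n u * rcnorm (2 * n + 1) m xs * rcnorm (2 * n + 1) m ys)%E) /\
  (* (c) *)
  (forall phi : op R -> R[i], is_lin phi -> cont_fun phi ->
   forall (n m : nat) (xs : nat -> op R), (0 < n)%N -> (0 < m)%N ->
     all_op m xs ->
     ((\sum_(j < m) cabs (phi (xs j)) ^+ 2)%:E <=
        K%:E * (fnorm n phi * rcnorm (2 * n + 1) m xs) ^+ 2)%E).
Proof.
have K0 : 0 < pi ^+ 2 / 6 :> R by rewrite divr_gt0 ?exprn_gt0 ?pi_gt0.
(* From here on [K] is an arbitrary positive constant for which the two square-sum estimates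
   hold. *)
exists (pi ^+ 2 / 6); split=> //; move: (pi ^+ 2 / 6) K0 (@sum_opnorm_sqr_rc R)
  (@sum_opnorm_sqr_absq R).
move=> K K0 rc ab.
split; [|split].
(* Dividing by 2K leaves an infimum on the right, so one representation at a time can be treated;
   each is also a competitor for the projective norm. *)
- move=> n m xs ys _ _ _; rewrite -lee_pdivrMl ?mulr_gt0 //.
  apply: le_ereal_inf_tmp => _ [m' [xs' [ys' [ax ay te ->]]]].
  rewrite lee_pdivrMl ?mulr_gt0 //.
  apply: (@le_trans _ _ (\sum_(j < m') opnorm n (xs' j) * opnorm n (ys' j))%E).
    by apply: ereal_inf_lbound; exists m', xs', ys'.
  have := sum_opnormM_le ax ay (ltW K0) (opnorm_ge0 _ _) (opnorm_ge0 _ _) (ab n _ _ ax)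
    (ab n _ _ ay).
  move=> /le_trans; apply; rewrite 2!esqrtE; apply: lee_wpmul2r.
    by rewrite mule_ge0 ?sqrte_ge0.
  by rewrite lee_fin; lra.
- move=> u bu cu n m xs ys _ _ ax ay.
  apply: (@le_trans _ _ (\sum_(j < m) bnorm n u * (opnorm n (xs j) * opnorm n (ys j)))%E).
    apply: (@le_trans _ _ (\sum_(j < m) (cabs (u (xs j) (ys j)))%:E)%E).
      by rewrite sumEFin lee_fin cabs_sum.
    by apply: lee_sum => j _; apply: bilin_bound => //; [exact: ax|exact: ay].
  rewrite -ge0_sume_distrr; last by move=> j _; rewrite mule_ge0 ?opnorm_ge0.
  have := sum_opnormM_le ax ay (ltW K0) (sqre_ge0 _) (sqre_ge0 _) (rc n _ _ ax) (rc n _ _ ay).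
  have rcE zs : sqrte (rcnorm (2 * n + 1) m zs ^+ 2)%E = rcnorm (2 * n + 1) m zs :> \bar R.
    by rewrite sqrte_sqr gee0_abs // rcnorm_ge0.
  rewrite 2!rcE; move: (rcnorm_ge0 (2 * n + 1) m xs) (rcnorm_ge0 (2 * n + 1) m ys).
  move: (rcnorm _ _ xs) (rcnorm _ _ ys) (bnorm_ge0 n u) => X Y; move: (bnorm n u) => b b0 X0 Y0 h.
  by rewrite -!muleA muleCA; apply: lee_wpmul2l.
(* Squaring [lin_bound] termwise leads directly to the square-sum estimate for the single family
   [xs]. *)
- move=> phi lp cp n m xs _ _ ax.
  apply: (@le_trans _ _ (\sum_(j < m) fnorm n phi ^+ 2 * opnorm n (xs j) ^+ 2)%E).
    rewrite -sumEFin; apply: lee_sum => j _.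
    rewrite EFin_expe !expe2 muleACA.
    by apply: lee_pmul; rewrite ?lee_fin ?cabs_ge0 //; apply: lin_bound => //; exact: ax.
  rewrite -ge0_sume_distrr; last by move=> j _; rewrite sqre_ge0.
  apply: (@le_trans _ _ (fnorm n phi ^+ 2 * (K%:E * rcnorm (2 * n + 1) m xs ^+ 2))%E).
    by apply: lee_wpmul2l; [rewrite sqre_ge0|exact: rc].
  by rewrite muleCA !expe2 muleACA.
Qed.
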